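(* For any integer $n\geq 6$, there exists a $2\text{-}\mathrm{RQLS}(n^2)$ with maximal cardinality.
   Context: Write $[v]=\{0,1,\ldots,v-1\}$ and let $\mathcal{H}_v=\mathbb{C}^v$ be the $v$-dimensional complex Hilbert space with its standard Hermitian inner product. A quantum Latin square of order $v$, denoted $\mathrm{QLS}(v)$, is a $v\times v$ array, rows and columns indexed by $[v]$, whose entries are unit vectors of $\mathcal{H}_v$ such that the entries of each row, and the entries of each column, form an orthonormal basis of $\mathcal{H}_v$. Two unit vectors $|\phi\rangle,|\psi\rangle\in\mathcal{H}_v$ are regarded as identical if $|\phi\rangle=e^{\mathrm{i}\theta}|\psi\rangle$ for some real $\theta$, and as distinct otherwise. The cardinality of a $\mathrm{QLS}(v)$ is the number of pairwise distinct vectors (in this sense) among its entries. It has maximal cardinality if its cardinality is $v^2$, i.e. any two entries in different cells are distinct (so for order $v=n^2$ the cardinality is $n^4$). A transversal of a $\mathrm{QLS}(v)$ is a set of $v$ cells, one in each row and one in each column, whose entries form an orthonormal basis of $\mathcal{H}_v$. Two transversals are disjoint if they have no common cell. For a positive integer $t$, a $\mathrm{QLS}(v)$ is called $t$-resolvable, and denoted $t\text{-}\mathrm{RQLS}(v)$, if it admits $t$ sets $\mathcal{T}^{(r)}=\{T^{(r)}_i: i\in[v]\}$, $r\in[t]$, each consisting of $v$ mutually disjoint transversals, such that $|T^{(r)}_i\cap T^{(s)}_j|=1$ for all $r,s\in[t]$ with $r\ne s$ and all $i,j\in[v]$. *)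

(* Defs.v *)
From mathcomp Require Import all_boot all_order all_algebra sesquilinear spectral.
From mathcomp Require Import complex boolp reals trigo.

Set Implicit Arguments.
Unset Strict Implicit.
Unset Printing Implicit Defensive.

Import Order.TTheory GRing.Theory Num.Theory.
Local Open Scope ring_scope.
Local Open Scope complex_scope.

Section QuantumLatinSquares.

Variables (R : realType) (v : nat).

(* [dotmx] is linear in the first and conjugate-linear in the second argument. *)
Local Notation H := 'rV[R[i]]_v.
Local Notation cell := ('I_v * 'I_v)%type.

(* The vectors are listed with multiplicity: a repeated vector is excluded. *)
Definition orthonormal_basis (s : seq H) : bool :=
  orthonormal (@dotmx R[i] v) s && basis_of {:H} s.

Definition is_QLS (Q : 'I_v -> 'I_v -> H) : Prop :=
  (forall i, orthonormal_basis [seq Q i j | j : 'I_v]) /\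
  (forall j, orthonormal_basis [seq Q i j | i : 'I_v]).

Definition same_up_to_phase (x y : H) : Prop :=
  exists theta : R, x = (cos theta +i* sin theta) *: y.

(* The number of vectors up to phase among the entries, counted as the number
   of classes of cells carrying identical entries. *)
Definition cardinality (Q : 'I_v -> 'I_v -> H) : nat :=
  #|equivalence_partition
      (fun c d : cell => `[< same_up_to_phase (Q c.1 c.2) (Q d.1 d.2) >])
      [set: cell]|.

Definition maximal_cardinality (Q : 'I_v -> 'I_v -> H) : Prop :=
  cardinality Q = (v ^ 2)%N.

Definition is_transversal_of (Q : 'I_v -> 'I_v -> H) (T : {set cell}) : Prop :=
  [/\ forall i, #|[set c in T | c.1 == i]| = 1%N,
      forall j, #|[set c in T | c.2 == j]| = 1%N
    & orthonormal_basis [seq Q c.1 c.2 | c in T]].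

Definition is_RQLS (t : nat) (Q : 'I_v -> 'I_v -> H) : Prop :=
  is_QLS Q /\
  exists T : 'I_t -> 'I_v -> {set cell},
    [/\ forall r i, is_transversal_of Q (T r i),
        forall r i j, i != j -> [disjoint T r i & T r j]
      & forall r s i j, r != s -> #|T r i :&: T s j| = 1%N].

End QuantumLatinSquares.

(* Main.v *)
Require Import Defs.
From HB Require Import structures.
From mathcomp Require Import all_boot all_order all_algebra sesquilinear spectral.
From mathcomp Require Import cyclic separable cyclotomic.
From mathcomp Require Import complex boolp reals trigo.
From mathcomp Require Import ring zify.

Set Implicit Arguments.
Unset Strict Implicit.
Unset Printing Implicit Defensive.

Import Order.TTheory GRing.Theory Num.Theory.
Local Open Scope ring_scope.

(** The theorem reduces to finding vectors with root-of-unity coordinates.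
    Index the cells by a finite set [X] of size [v ^ 2], and let four maps
    [d i : X -> A], with [#|A| = v], record the row, the column and the two
    transversals through a cell.  The classical part asks that any two of
    these maps determine the cell: then rows and columns coordinatise the
    array, and the last two maps cut out two families of transversals meeting
    each other in single cells.  The quantum part asks for vectors
    [e c : A -> C] that are orthogonal for distinct cells on a common line and
    never proportional.  If the coordinates are N-th roots of unity all norms
    equal [sqrt v], and the array is realised after rescaling
    ([flat_order_RQLS]).

    When [A] is an abelian group with a nondegenerate bicharacter [chi], the
    cells are the pairs [(x, y)], the lines are the cosets of the four subgroups
    [x = 0], [y = 0], [y = x], [y = nu x], and the vectors are
    [e (x, y) z = chi x z * chi y (b z)] for a map [b : A -> A].  The inner
    product of two cells on a line is the sum over [z] of a nontrivial character
    evaluated at [z], [b z], [z + b z] or [z + nu' (b z)], with [nu'] the adjoint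
    of [nu]; so it vanishes as soon as these four maps of [z] are permutations
    ([phase_ortho]).  A linear [b] would give only [v] vectors up to phase; a
    sufficiently nonlinear [b] separates all [v ^ 2] of them
    ([phase_distinct]).

    Such a [b] comes from a quadratic extension with generator [t]: let
    [b z = t z] or [b z = t' z] (with [t'] the conjugate of [t]) according to
    the norm of [z].  If [nu] is fixed by conjugation then [t] and [t'], [1 + t]
    and [1 + t'], [1 + nu t] and [1 + nu t'] have the same norms.  When these
    norms are units, the norm of the image gives back the norm of [z], hence the
    branch that was used, and each branch is injective.
    This works in the Gaussian integers modulo an odd [m >= 3], with
    [t = i] and [nu = -1], giving order [m ^ 2] ([flat_order_odd_square]), and in
    the field with 16 elements over the field with 4 elements, with [nu] a
    primitive cube root of unity, giving order 16 ([flat_order16]).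

    Finally order [v] yields order [4 * v] ([flat_order_quadruple]): take the
    product with the net of the field with 4 elements, whose fifth parallel
    class provides a classical symbol, and let the cell of the small net change
    the phase of a single coordinate of the old vectors by a root of unity of
    larger order; this separates the cells that share a symbol.  Writing [n] as
    an odd number, as 4, or as twice a number [>= 3] gives every [n >= 3]. *)

(** * Flat arrays *)

(** [d] assigns to a cell its row, its column and its two transversals, and
    [e] its unnormalised vector.  Keeping the cells abstract, instead of taking
    them to be pairs (row, column), makes the four line classes
    interchangeable and products of arrays immediate. *)
Record flat_array (C : numClosedFieldType) (N : nat) (X A : finType)
    (d : 'I_4 -> X -> A) (e : X -> A -> C) : Prop := FlatArray {
  flat_card : #|X| = (#|A| ^ 2)%N;
  flat_exp_gt0 : (0 < N)%N;
  flat_unity : forall c z, e c z ^+ N = 1;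
  flat_net : forall i j, i != j -> injective (fun c => (d i c, d j c));
  flat_ortho : forall i c c', d i c = d i c' -> c != c' ->
    \sum_z e c z * (e c' z)^* = 0;
  flat_distinct : forall c c' k, (forall z, e c z = k * e c' z) -> c = c' }.

Definition flat_order (C : numClosedFieldType) (v : nat) : Prop :=
  exists (N : nat) (X A : finType) (d : 'I_4 -> X -> A) (e : X -> A -> C),
    flat_array N d e /\ #|A| = v.

(** * Roots of unity *)

Section Unity.
Variable C : numClosedFieldType.

(** In characteristic 0 the polynomial [X ^ n - 1] is separable, so it has [n]
    distinct roots, and a finite subgroup of a field is cyclic. *)
Lemma prim_root_existsC n : (0 < n)%N -> exists z : C, n.-primitive_root z.
Proof.
move=> n_gt0; have [r] := closed_field_poly_normal ('X^n - 1 : {poly C}).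
rewrite (monicP (monicXnsubC 1 n_gt0)) scale1r => r_roots.
have r_unity : all n.-unity_root r.
  by apply/allP => z zr; rewrite /root_of_unity r_roots root_prod_XsubC.
have r_uniq : uniq r.
  rewrite -separable_prod_XsubC -r_roots separable_Xn_sub_1 //.
  by rewrite pnatr_eq0 -lt0n.
have size_r : size r = n.
  by have := size_XnsubC (1 : C) n_gt0; rewrite r_roots size_prod_XsubC => -[].
have /hasP [z _ z_prim] := has_prim_root n_gt0 r_unity r_uniq (eq_leq (esym size_r)).
by exists z.
Qed.

Lemma unity_mul_conj N (z : C) : (0 < N)%N -> z ^+ N = 1 -> z * z^* = 1.
Proof.
move=> N0 zN; rewrite -normCK; apply/eqP.
rewrite -(@pexpr_eq1 _ _ N) ?exprn_ge0 //.
by rewrite exprAC -normrX zN normr1 expr1n.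
Qed.

Lemma unity_neq0 N (z : C) : (0 < N)%N -> z ^+ N = 1 -> z != 0.
Proof.
by move=> N0 zN; apply: contra_eq_neq zN => ->; rewrite expr0n gtn_eqF //
  eq_sym oner_eq0.
Qed.

Lemma unity_conj N (z : C) : (0 < N)%N -> z ^+ N = 1 -> z^* = z^-1.
Proof.
move=> N0 zN; apply: (mulfI (unity_neq0 N0 zN)).
by rewrite (unity_mul_conj N0 zN) divff // (unity_neq0 N0 zN).
Qed.

End Unity.

(** * Arrays from characters of an abelian group *)

Section Character.
Variables (C : numClosedFieldType) (N : nat) (A : finZmodType).
Variables (chi : A -> A -> C) (nu nu' b : A -> A).
Hypothesis N_gt0 : (0 < N)%N.
Hypothesis chi_unity : forall x z, chi x z ^+ N = 1.
Hypothesis chiDl : forall x x' z, chi (x + x') z = chi x z * chi x' z.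
Hypothesis chiDr : forall x z z', chi x (z + z') = chi x z * chi x z'.
Hypothesis chi_nondeg : forall x, (forall z, chi x z = 1) -> x = 0.
Hypothesis nuB : forall x x', nu (x - x') = nu x - nu x'.
Hypothesis nu_inj : injective nu.
Hypothesis nu_fix : forall x, nu x = x -> x = 0.
Hypothesis chi_nu : forall x z, chi (nu x) z = chi x (nu' z).
Hypothesis b_inj : injective b.
Hypothesis b1_inj : injective (fun z => z + b z).
Hypothesis bnu_inj : injective (fun z => z + nu' (b z)).
Hypothesis b0 : b 0 = 0.
Hypothesis b_generic :
  forall x y, (forall z, chi x z * chi y (b z) = 1) -> x = 0 /\ y = 0.

Definition slope_line (i : 'I_4) (c : A * A) : A :=
  nth 0 [:: c.1; c.2; c.2 - c.1; c.2 - nu c.1] i.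

Definition phase_vector (c : A * A) (z : A) : C := chi c.1 z * chi c.2 (b z).

Let chi_neq0 x z : chi x z != 0.
Proof. exact: unity_neq0 N_gt0 (chi_unity x z). Qed.

Let chi0l z : chi 0 z = 1.
Proof. by apply: (mulfI (chi_neq0 0 z)); rewrite -chiDl addr0 mulr1. Qed.

Let chi0r x : chi x 0 = 1.
Proof. by apply: (mulfI (chi_neq0 x 0)); rewrite -chiDr addr0 mulr1. Qed.

Let chiB x x' z : chi (x - x') z = chi x z * (chi x' z)^*.
Proof.
rewrite (unity_conj N_gt0 (chi_unity x' z)); apply: (mulIf (chi_neq0 x' z)).
by rewrite -chiDl subrK mulfVK.
Qed.

Lemma sum_character x : x != 0 -> \sum_z chi x z = 0.
Proof.
move=> x0; case: (pselect (forall z, chi x z = 1)) => [/chi_nondeg /eqP|].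
  by rewrite (negPf x0).
move=> /existsNP [w /eqP cw].
have E : \sum_z chi x z = chi x w * \sum_z chi x z.
  rewrite mulr_sumr (reindex_inj (addrI w)) /=.
  by apply: eq_bigr => z _; rewrite chiDr.
apply/eqP; move/eqP: E; rewrite -subr_eq0 -{1}[\sum_z _]mul1r -mulrBl mulf_eq0.
by rewrite subr_eq0 eq_sym (negPf cw).
Qed.

Let sum_character_inj (g : A -> A) x :
  injective g -> x != 0 -> \sum_z chi x (g z) = 0.
Proof. by move=> g_inj /sum_character; rewrite (reindex_inj g_inj). Qed.

Let nu0 : nu 0 = 0.
Proof. by rewrite -[X in nu X](subrr 0) nuB subrr. Qed.

Let slope_lineB i c c' :
  slope_line i c = slope_line i c' -> slope_line i (c - c') = 0.
Proof.
case: c c' => [x y] [x' y']; case: i => [[|[|[|[|//]]]] ?] /= E;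
  rewrite /slope_line /= ?nuB in E *.
- by rewrite E subrr.
- by rewrite E subrr.
- by rewrite opprD addrACA E -opprD subrr.
- by rewrite opprD addrACA E -opprD subrr.
Qed.

(** The differences of the slopes 0, infinity, 1 and [nu] are invertible. *)
Lemma slope_net i j : i != j ->
  injective (fun c => (slope_line i c, slope_line j c)).
Proof.
move=> ij c c' [/slope_lineB Ei /slope_lineB Ej].
apply: subr0_eq; move: (c - c') Ei Ej => [x y] {c c'}.
have nu_eq0 u : 0 = nu u -> u = 0 by move=> E; apply: nu_inj; rewrite nu0.
move: ij.
case: i => [[|[|[|[|i]]]] ilt]; case: j => [[|[|[|[|j]]]] jlt];
  rewrite ?(ltnNge 4) // => _; rewrite /slope_line /=.
- by move=> -> ->.
- by move=> -> /subr0_eq ->.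
- by move=> -> /subr0_eq ->; rewrite nu0.
- by move=> -> ->.
- by move=> -> /subr0_eq <-.
- by move=> -> /subr0_eq /nu_eq0 ->.
- by move=> /subr0_eq -> ->.
- by move=> /subr0_eq <- ->.
- by move=> /subr0_eq -> /subr0_eq /esym /nu_fix ->.
- by move=> /subr0_eq -> ->; rewrite nu0.
- by move=> /subr0_eq E y0; move: E; rewrite y0 => /nu_eq0 ->.
- by move=> /subr0_eq -> /subr0_eq /nu_fix ->; rewrite nu0.
Qed.

Let phase_conj c c' z : phase_vector c z * (phase_vector c' z)^* =
  chi (c - c').1 z * chi (c - c').2 (b z).
Proof. by rewrite /phase_vector rmorphM !chiB /=; ring. Qed.

(** On each line class [x] and [y] are tied by a linear relation, which turns
    the inner product into the sum of one character along a permutation. *)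
Lemma phase_ortho i c c' : slope_line i c = slope_line i c' -> c != c' ->
  \sum_z phase_vector c z * (phase_vector c' z)^* = 0.
Proof.
move=> /slope_lineB; rewrite -subr_eq0; under eq_bigr do rewrite phase_conj.
move: (c - c') => [x y] {c c'}.
rewrite -[_ == 0]/((x == 0) && (y == 0)) /slope_line /=.
case: i => [[|[|[|[|//]]]] ?] /=.
- move=> ->; rewrite eqxx => y0; under eq_bigr do rewrite chi0l mul1r.
  exact: sum_character_inj.
- move=> ->; rewrite eqxx andbT => x0; under eq_bigr do rewrite chi0l mulr1.
  exact: sum_character.
- move=> /subr0_eq ->; rewrite andbb => x0; under eq_bigr do rewrite -chiDr.
  exact: (@sum_character_inj (fun z => z + b z)).
- move=> /subr0_eq ->; have [-> |x0 _] := eqVneq x 0; first by rewrite nu0 eqxx.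
  under eq_bigr do rewrite chi_nu -chiDr.
  exact: (@sum_character_inj (fun z => z + nu' (b z))).
Qed.

(** Normalising [b 0 = 0] makes every vector take the value 1 at 0, so that
    proportional vectors are equal. *)
Lemma phase_distinct c c' k :
  (forall z, phase_vector c z = k * phase_vector c' z) -> c = c'.
Proof.
move=> E; have k1 : k = 1.
  by have := E 0; rewrite /phase_vector b0 !chi0r !mul1r mulr1.
apply: subr0_eq; case: (b_generic (x := (c - c').1) (y := (c - c').2)) => [z|].
  rewrite -phase_conj E k1 mul1r (unity_mul_conj N_gt0) //.
  by rewrite exprMn !chi_unity mulr1.
by case: (c - c') => x y /= -> ->.
Qed.

Lemma flat_order_of_characters : flat_order C #|A|.
Proof.
exists N, (A * A)%type, A, slope_line, phase_vector; split=> //.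
split=> //.
- by rewrite card_prod.
- by move=> c z; rewrite exprMn !chi_unity mulr1.
- exact: slope_net.
- exact: phase_ortho.
- exact: phase_distinct.
Qed.

End Character.

(** * The fields with 4 and 16 elements *)

(** The pair [(a, b)] stands for [a + b * omega], where
    [omega ^ 2 = omega + 1].  Both coordinates are booleans so that identities
    and injectivity statements can be checked by enumeration. *)
Definition F4 : Type := (bool * bool)%type.
HB.instance Definition _ := GRing.Zmodule.on F4.
HB.instance Definition _ := Finite.on F4.

Definition omega (a : F4) : F4 := (a.2, a.1 + a.2).
Definition mulF4 (a b : F4) : F4 :=
  (a.1 * b.1 + a.2 * b.2, a.1 * b.2 + a.2 * b.1 + a.2 * b.2).

(** Multiplication by [omega] has a symmetric matrix, so the plain dot product
    of bit vectors makes it self-adjoint. *)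
Definition dotF4 (a b : F4) : bool := a.1 * b.1 + a.2 * b.2.

(** [(z1, z2)] stands for [z1 + z2 * t], where [t ^ 2 = t + omega]; the
    conjugate of [t] is [t + 1]. *)
Definition F16 : Type := (F4 * F4)%type.
HB.instance Definition _ := GRing.Zmodule.on F16.
HB.instance Definition _ := Finite.on F16.

Definition normF16 (z : F16) : F4 :=
  mulF4 z.1 z.1 + mulF4 z.1 z.2 + omega (mulF4 z.2 z.2).

(** Multiplication by the conjugate of [t] on the elements of norm 1, and by
    [t] elsewhere. *)
Definition twistF16 (z : F16) : F16 :=
  if normF16 z == (true, false) then (z.1 + omega z.2, z.1)
  else (omega z.2, z.1 + z.2).
Definition omegaF16 (z : F16) : F16 := (omega z.1, omega z.2).
Definition dotF16 (x z : F16) : bool := dotF4 x.1 z.1 + dotF4 x.2 z.2.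

Lemma dotF16Dl x y z : dotF16 (x + y) z = dotF16 x z + dotF16 y z.
Proof.
by case: x y z => [[? ?] [? ?]] [[? ?] [? ?]] [[? ?] [? ?]];
  rewrite /dotF16 /dotF4 /=; ring.
Qed.

Lemma dotF16C x z : dotF16 x z = dotF16 z x.
Proof.
by case: x z => [[? ?] [? ?]] [[? ?] [? ?]];
  rewrite /dotF16 /dotF4 /=; ring.
Qed.

Lemma dotF16_omega x z : dotF16 (omegaF16 x) z = dotF16 x (omegaF16 z).
Proof.
by case: x z => [[? ?] [? ?]] [[? ?] [? ?]];
  rewrite /dotF16 /dotF4 /=; ring.
Qed.

Lemma twistF16_inj : injective twistF16.
Proof. by move=> [[[] []] [[] []]] [[[] []] [[] []]]. Qed.

Lemma twistF16_add_inj : injective (fun z => z + twistF16 z).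
Proof. by move=> [[[] []] [[] []]] [[[] []] [[] []]]. Qed.

Lemma twistF16_omega_inj : injective (fun z => z + omegaF16 (twistF16 z)).
Proof. by move=> [[[] []] [[] []]] [[[] []] [[] []]]. Qed.

Lemma twistF16_generic x y :
  (forall z, dotF16 x z + dotF16 y (twistF16 z) = 0) -> x = 0 /\ y = 0.
Proof.
(* These eight elements already detect every nonzero pair [(x, y)]. *)
move=> E; have {E} : all (fun z => dotF16 x z + dotF16 y (twistF16 z) == 0)
    [:: ((false, false), (false, true)); ((false, false), (true, false));
        ((false, false), (true, true)); ((false, true), (false, false));
        ((false, true), (false, true)); ((false, true), (true, true));
        ((true, false), (false, false)); ((true, false), (false, true))].
  by apply/allP => z _; apply/eqP; apply: E.
by case: x y => [[[] []] [[] []]] [[[] []] [[] []]].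
Qed.

Lemma sign_eq1 (C : numClosedFieldType) (a : bool) :
  (-1) ^+ a = 1 :> C -> a = 0.
Proof.
by case: a => // /eqP; rewrite expr1 lt_eqF // (lt_trans (ltrN10 C) ltr01).
Qed.

Lemma flat_order16 (C : numClosedFieldType) : flat_order C 16%N.
Proof.
have <- : #|{: F16}| = 16%N by rewrite !card_prod card_bool.
apply: (@flat_order_of_characters C 2 F16 (fun x z => (-1) ^+ dotF16 x z)
  omegaF16 omegaF16 twistF16) => //.
- by move=> x z; rewrite sqrr_sign.
- by move=> x x' z; rewrite dotF16Dl signr_addb.
- by move=> x z z'; rewrite dotF16C dotF16Dl signr_addb !(dotF16C x).
- move=> x E; have := (sign_eq1 (E ((true, false), 0)),
    sign_eq1 (E ((false, true), 0)), sign_eq1 (E (0, (true, false))),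
    sign_eq1 (E (0, (false, true)))).
  by case: x {E} => [[[] []] [[] []]] [] [] [].
- by move=> [[[] []] [[] []]] [[[] []] [[] []]].
- by move=> [[[] []] [[] []]] [[[] []] [[] []]].
- by move=> [[[] []] [[] []]].
- by move=> x z; rewrite dotF16_omega.
- exact: twistF16_inj.
- exact: twistF16_add_inj.
- exact: twistF16_omega_inj.
- move=> x y E; apply: twistF16_generic => z.
  by apply: (@sign_eq1 C); rewrite signr_addb E.
Qed.

(** * Gaussian integers modulo an odd number *)

(** The pair [(a, b)] stands for [a + b * i]. *)
Definition gauss (m : nat) : Type := ('Z_m * 'Z_m)%type.
HB.instance Definition _ m := GRing.Zmodule.on (gauss m).
HB.instance Definition _ m := Finite.on (gauss m).

Section OddSquare.
Variables (C : numClosedFieldType) (m : nat).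
Hypotheses (m_gt1 : (1 < m)%N) (m_odd : odd m).
Local Notation Zi := (gauss m).

Let two_unit : (2 : 'Z_m) \is a GRing.unit.
Proof. by rewrite unitZpE // coprimen2 m_odd. Qed.

Let mul2_eq0 (a : 'Z_m) : 2 * a = 0 -> a = 0.
Proof. by move=> E; apply: (mulrI two_unit); rewrite E mulr0. Qed.

Definition norm_gauss (z : Zi) : 'Z_m := z.1 ^+ 2 + z.2 ^+ 2.

(** Multiplication by [-i] on the elements of norm 1, and by [i] elsewhere. *)
Definition twist_gauss (z : Zi) : Zi :=
  if norm_gauss z == 1 then (z.2, - z.1) else (- z.2, z.1).
Definition dot_gauss (x z : Zi) : 'Z_m := x.1 * z.1 + x.2 * z.2.

Let norm_twist z : norm_gauss (twist_gauss z) = norm_gauss z.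
Proof. by rewrite /twist_gauss; case: ifP => _; rewrite /norm_gauss /=; ring. Qed.

Let norm_addtwist z : norm_gauss (z + twist_gauss z) = 2 * norm_gauss z.
Proof. by rewrite /twist_gauss; case: ifP => _; rewrite /norm_gauss /=; ring. Qed.

Let norm_subtwist z : norm_gauss (z - twist_gauss z) = 2 * norm_gauss z.
Proof. by rewrite /twist_gauss; case: ifP => _; rewrite /norm_gauss /=; ring. Qed.

(** Multiplication by [1 + i] and [1 - i] is injective, since 2 is a unit. *)
Let sum_diff_inj (a b a' b' : 'Z_m) :
  a + b = a' + b' -> a - b = a' - b' -> a = a' /\ b = b'.
Proof.
move=> Es Ed; split; apply: subr0_eq; apply: mul2_eq0.
- have -> : 2 * (a - a') = (a + b - (a' + b')) + (a - b - (a' - b')) by ring.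
  by rewrite Es Ed !subrr addr0.
- have -> : 2 * (b - b') = (a + b - (a' + b')) - (a - b - (a' - b')) by ring.
  by rewrite Es Ed !subrr.
Qed.

(** Multiplication by [i] or [-i] preserves the norm, so the norm of the image
    reveals the branch. *)
Lemma twist_gauss_inj : injective twist_gauss.
Proof.
move=> z z' E; have := congr1 norm_gauss E; rewrite !norm_twist => En.
move: E; rewrite /twist_gauss En; case: ifP => _; case: z z' {En} => x y [x' y'] E;
  have /= E1 := congr1 fst E; have /= E2 := congr1 snd E.
- by rewrite E1 (oppr_inj E2).
- by rewrite E2 (oppr_inj E1).
Qed.

(** Both [1 + i] and [1 - i] have norm 2, a unit: again the norm of the image
    reveals the branch. *)
Lemma twist_gauss_add_inj : injective (fun z => z + twist_gauss z).
Proof.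
move=> z z' /= E; have /(mulrI two_unit) En : 2 * norm_gauss z = 2 * norm_gauss z'.
  by rewrite -!norm_addtwist E.
move: E; rewrite /twist_gauss En; case: ifP => _; case: z z' {En} => x y [x' y'] E;
  have /= E1 := congr1 fst E; have /= E2 := congr1 snd E.
- by have [||-> ->] := @sum_diff_inj y x y' x'; rewrite // addrC E1 addrC.
- by have [||-> ->] := @sum_diff_inj x y x' y'; rewrite // addrC E2 addrC.
Qed.

Lemma twist_gauss_sub_inj : injective (fun z => z - twist_gauss z).
Proof.
move=> z z' /= E; have /(mulrI two_unit) En : 2 * norm_gauss z = 2 * norm_gauss z'.
  by rewrite -!norm_subtwist E.
move: E; rewrite /twist_gauss En; case: ifP => _; case: z z' {En} => x y [x' y'] E;
  have /= E1 := congr1 fst E; have /= E2 := congr1 snd E;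
  rewrite !opprK in E1 E2.
- by have [||-> ->] := @sum_diff_inj x y x' y'; rewrite // addrC E2 addrC.
- by have [||-> ->] := @sum_diff_inj y x y' x'; rewrite // addrC E1 addrC.
Qed.

Let norm_e1 : norm_gauss (1, 0) = 1. Proof. by rewrite /norm_gauss /=; ring. Qed.
Let norm_e2 : norm_gauss (0, 1) = 1. Proof. by rewrite /norm_gauss /=; ring. Qed.

Let two_neq1 : (2 : 'Z_m) != 1.
Proof. by rewrite -subr_eq0 (_ : 2 - 1 = 1) ?oner_eq0 //; ring. Qed.

(** The elements 1 and [i] lie in the branch of norm 1, [1 + i] and [1 - i] in
    the other one; the four relations they give have only the zero solution,
    again because 2 is a unit. *)
Lemma twist_gauss_generic x y :
  (forall z, dot_gauss x z + dot_gauss y (twist_gauss z) = 0) -> x = 0 /\ y = 0.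
Proof.
case: x y => [x1 x2] [y1 y2] E.
have := E (1, 0); rewrite /twist_gauss norm_e1 eqxx /dot_gauss /= => E1.
have := E (0, 1); rewrite /twist_gauss norm_e2 eqxx /dot_gauss /= => E2.
have := E (1, 1); rewrite /twist_gauss /norm_gauss /= !expr1n (negPf two_neq1).
rewrite /dot_gauss /= => E3.
have := E (1, -1); rewrite /twist_gauss /norm_gauss /= sqrrN !expr1n (negPf two_neq1).
rewrite /dot_gauss /= => E4 {E}.
have E1' : x1 = y2 by apply: subr0_eq; rewrite -E1; ring.
have E2' : x2 = - y1 by apply: subr0_eq; rewrite -E2; ring.
have X1 : x1 = 0.
  do 2 apply: mul2_eq0; rewrite -[RHS]addr0 -{1}E3 -E4 -E1'; ring.
have Y1 : y1 = 0.
  apply: mul2_eq0; apply: oppr_inj; rewrite oppr0 -E3.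
  by rewrite -E1' X1 E2'; ring.
by rewrite E2' -E1' X1 Y1 oppr0.
Qed.

Variable w : C.
Hypothesis w_prim : m.-primitive_root w.

Let w_unity : w ^+ m = 1. Proof. exact: prim_expr_order. Qed.

Let expZpD (a b : 'Z_m) : w ^+ (a + b)%R = w ^+ a * w ^+ b.
Proof.
rewrite -exprD -(expr_mod (a + b)%N w_unity) /=; congr (w ^+ (_ %% _)).
by rewrite Zp_cast.
Qed.

Let expZp_eq1 (a : 'Z_m) : w ^+ a = 1 -> a = 0.
Proof.
have a_lt : (a < m)%N by rewrite -[m in (_ < m)%N](Zp_cast m_gt1) ltn_ord.
move/eqP; rewrite -(prim_order_dvd w_prim) => a_dvd; apply: val_inj => /=.
by apply/eqP; move: a_dvd; apply: contraLR; rewrite -lt0n => a0; rewrite gtnNdvd.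
Qed.

Lemma flat_order_odd_square : flat_order C (m ^ 2).
Proof.
have <- : #|{: Zi}| = (m ^ 2)%N.
  by rewrite card_prod card_ord Zp_cast.
have dotC x z : dot_gauss x z = dot_gauss z x by rewrite /dot_gauss /=; ring.
have dotD x x' z : dot_gauss (x + x') z = dot_gauss x z + dot_gauss x' z.
  by rewrite /dot_gauss /=; ring.
apply: (@flat_order_of_characters C m Zi (fun x z => w ^+ dot_gauss x z)
  -%R -%R twist_gauss).
- exact: ltnW.
- by move=> x z; rewrite exprAC w_unity expr1n.
- by move=> x x' z; rewrite dotD expZpD.
- by move=> x z z'; rewrite dotC dotD expZpD !(dotC x).
- move=> [x1 x2] E; have := expZp_eq1 (E (1, 0)); have := expZp_eq1 (E (0, 1)).
  by rewrite /dot_gauss /= !mulr0 !mulr1 addr0 add0r => -> ->.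
- by move=> x x'; rewrite opprB opprK addrC.
- exact: oppr_inj.
- case=> x1 x2 [E1 E2]; congr (_, _); apply: mul2_eq0.
    by rewrite mulr_natl mulr2n -{1}E1 addNr.
  by rewrite mulr_natl mulr2n -{1}E2 addNr.
- move=> x z; suff -> : dot_gauss (- x) z = dot_gauss x (- z) by [].
  by rewrite /dot_gauss /=; ring.
- exact: twist_gauss_inj.
- exact: twist_gauss_add_inj.
- exact: twist_gauss_sub_inj.
- have n0 : norm_gauss 0 = 0 by rewrite /norm_gauss /=; ring.
  by rewrite /twist_gauss n0 eq_sym oner_eq0 oppr0.
- move=> x y E; apply: twist_gauss_generic => z.
  by apply: expZp_eq1; rewrite expZpD E.
Qed.

End OddSquare.

(** * Multiplying the order by four *)

(** The slope of [symbolF4] differs from the four slopes of [lineF4]: the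
    affine plane over the field with 4 elements has five parallel classes. *)
Definition lineF4 (i : 'I_4) (c : F4 * F4) : F4 :=
  nth 0 [:: c.1; c.2; c.2 - c.1; c.2 - omega c.1] i.
Definition symbolF4 (c : F4 * F4) : F4 := c.1 + omega c.2.
Definition indexF4 (c : F4 * F4) : nat := (c.1.1 + c.1.2.*2)%N.

Lemma lineF4_net i j : i != j -> injective (fun c => (lineF4 i c, lineF4 j c)).
Proof.
case: i j => [[|[|[|[|i]]]] ilt] [[|[|[|[|j]]]] jlt] //;
  rewrite ?(ltnNge 4) // => _;
by move=> [[[] []] [[] []]] [[[] []] [[] []]].
Qed.

Lemma symbolF4_line i : injective (fun c => (lineF4 i c, symbolF4 c)).
Proof.
by case: i => [[|[|[|[|i]]]] ilt] [[[] []] [[] []]] [[[] []] [[] []]].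
Qed.

(** The symbol and the first coordinate determine the second one, as
    multiplication by [omega] is invertible. *)
Lemma symbolF4_index c c' :
  symbolF4 c = symbolF4 c' -> indexF4 c = indexF4 c' -> c = c'.
Proof. by case: c c' => [[[] []] [[] []]] [[[] []] [[] []]]. Qed.

Lemma indexF4_lt c : (indexF4 c < 4)%N.
Proof. by case: c => [[[] []] ?]. Qed.

Section Quadruple.
Variables (C : numClosedFieldType) (N : nat) (X A : finType).
Variables (d : 'I_4 -> X -> A) (e : X -> A -> C) (w : C) (a0 a1 : A).
Hypothesis de : flat_array N d e.
Hypothesis w_prim : (4 * N)%N.-primitive_root w.
Hypothesis a10 : a1 != a0.

Definition charF4 (s z : F4) : C := (-1) ^+ dotF4 s z.

Lemma charF4_ortho s s' : s != s' -> \sum_z charF4 s z * (charF4 s' z)^* = 0.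
Proof.
rewrite /charF4 => ss'.
rewrite (eq_bigr (fun z => (-1) ^+ dotF4 (s - s') z)); last first.
  move=> z _; rewrite rmorph_sign -signr_addb.
  by case: s s' z {ss'} => [[] []] [[] []] [[] []].
rewrite -(pair_bigA _ (fun z1 z2 => (-1) ^+ dotF4 (s - s') (z1, z2))) /=.
rewrite !big_bool /=.
by case: s s' ss' => [[] []] [[] []] // _; rewrite /dotF4 /= ?(expr0, expr1); ring.
Qed.

Lemma charF4_inj s s' : charF4 s =1 charF4 s' -> s = s'.
Proof.
move=> E; apply/eqP; apply/negPn/negP => /charF4_ortho.
rewrite (eq_bigr (fun=> 1)); last first.
  by move=> z _; rewrite E rmorph_sign -expr2 sqrr_sign.
by move/eqP; rewrite sumr_const pnatr_eq0 card_prod card_bool.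
Qed.

Definition twisted_line i (c : (F4 * F4) * X) : F4 * A :=
  (lineF4 i c.1, d i c.2).

(** A diagonal unitary depending on the cell of the small net alone: for a fixed
    such cell it preserves the orthogonality of the vectors [e].  One altered
    coordinate is enough, as the others show the scalar between two
    proportional vectors. *)
Definition twist (c : F4 * F4) (a : A) : C :=
  if a == a0 then w ^+ indexF4 c else 1.
Definition twisted_vector (c : (F4 * F4) * X) (z : F4 * A) : C :=
  charF4 (symbolF4 c.1) z.1 * (twist c.1 z.2 * e c.2 z.2).

Let N_gt0 := flat_exp_gt0 de.
Let w_unity : w ^+ (4 * N) = 1. Proof. exact: prim_expr_order. Qed.

Lemma twist_unity c a : twist c a ^+ (4 * N) = 1.
Proof. by rewrite /twist; case: ifP; rewrite ?expr1n // exprAC w_unity expr1n. Qed.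

Lemma charF4_unity s z : charF4 s z ^+ (4 * N) = 1.
Proof. by rewrite /charF4 exprM (exprM _ 2 2) sqrr_sign !expr1n. Qed.

(** Orthogonality: on a line, distinct symbols are separated by the characters,
    and equal symbols force equal cells of the small net, hence equal twists,
    which cancel.  Distinctness: at a coordinate other than [a0] the twist is
    invisible and the symbol can be read off; comparing N-th powers at [a0],
    where the values of [e] disappear, reveals the index. *)
Lemma twisted_array : flat_array (4 * N) twisted_line twisted_vector.
Proof.
split.
- by rewrite !card_prod (flat_card de) expnMn !card_bool.
- by rewrite muln_gt0.
- move=> [c x] [z a]; rewrite /twisted_vector !exprMn charF4_unity twist_unity.
  by rewrite mulnC exprM (flat_unity de) expr1n !mulr1.
- move=> i j ij [c x] [c' x'] [Ei Ei' Ej Ej']; congr (_, _).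
    by apply: (lineF4_net ij); rewrite Ei Ej.
  by apply: (flat_net de ij); rewrite Ei' Ej'.
- move=> i [c x] [c' x'] [Ei Ei'] ne.
  have -> : \sum_z twisted_vector (c, x) z * (twisted_vector (c', x') z)^* =
     (\sum_z charF4 (symbolF4 c) z * (charF4 (symbolF4 c') z)^*) *
     (\sum_a (twist c a * e x a) * (twist c' a * e x' a)^*).
    rewrite big_distrlr /= pair_bigA /=; apply: eq_bigr => -[z a] _ /=.
    by rewrite /twisted_vector /= !rmorphM /=; ring.
  have [Es|/charF4_ortho ->] := eqVneq (symbolF4 c) (symbolF4 c'); last first.
    exact: mul0r.
  have Ec : c = c' by apply: (@symbolF4_line i); rewrite Ei Es.
  rewrite -Ec in ne *; have xx' : x != x' by apply: contraNneq ne => ->.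
  rewrite [X in _ * X](_ : _ = 0) ?mulr0 // -[RHS](flat_ortho de Ei' xx').
  apply: eq_bigr => a _; rewrite rmorphM mulrACA.
  by rewrite (unity_mul_conj _ (twist_unity c a)) ?mul1r // muln_gt0.
- move=> [c x] [c' x'] k E.
  have e_neq0 y a : e y a != 0 := unity_neq0 N_gt0 (flat_unity de y a).
  have char0 s : charF4 s 0 = 1 by case: s => [[] []].
  have E1 a : a != a0 -> e x a = k * e x' a.
    move=> /negPf aa0; have := E (0, a).
    by rewrite /twisted_vector /twist /= aa0 !char0 !mul1r.
  have Es : symbolF4 c = symbolF4 c'.
    have u0 : k * e x' a1 != 0 by rewrite -E1.
    apply: charF4_inj => z; apply: (mulIf u0); have := E (z, a1).
    rewrite /twisted_vector /twist /= (negPf a10) !mul1r E1 // => ->.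
    exact: mulrCA.
  have E0 : w ^+ indexF4 c * e x a0 = k * (w ^+ indexF4 c' * e x' a0).
    have := E (0, a0).
    by rewrite /twisted_vector /twist /= eqxx !char0 !mul1r.
  have kN : k ^+ N = 1.
    have /(congr1 (fun y => y ^+ N)) := E1 _ a10.
    by rewrite exprMn !(flat_unity de) mulr1.
  have Ei : indexF4 c = indexF4 c'.
    have /(congr1 (fun y => y ^+ N)) := E0.
    rewrite !exprMn !(flat_unity de) kN mul1r !mulr1 -!exprM => /eqP.
    rewrite (eq_prim_root_expr w_prim) !modn_small ?ltn_pmul2r ?indexF4_lt //.
    by rewrite eqn_pmul2r // => /eqP.
  have Ec := symbolF4_index Es Ei; rewrite -Ec; congr (_, _).
  apply: (flat_distinct de (k := k)) => a.
  have [->|/E1 //] := eqVneq a a0; move: E0; rewrite -Ei mulrCA.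
  by apply: mulfI; rewrite expf_neq0 // (prim_root_eq0 w_prim) muln_eq0 -lt0n
    N_gt0.
Qed.

End Quadruple.

Lemma flat_order_quadruple (C : numClosedFieldType) v :
  (1 < v)%N -> flat_order C v -> flat_order C (4 * v).
Proof.
move=> v1 [N [X [A [d [e [de Av]]]]]].
have /card_gt1P [a0 [a1 [_ _ a01]]] : (1 < #|A|)%N by rewrite Av.
have [|w w_prim] := @prim_root_existsC C (4 * N).
  by rewrite muln_gt0 (flat_exp_gt0 de).
exists (4 * N)%N, ((F4 * F4) * X)%type, (F4 * A)%type.
exists (twisted_line d), (twisted_vector e w a0).
split; last by rewrite !card_prod card_bool Av.
by apply: (@twisted_array _ _ _ _ _ _ _ _ a1) => //; rewrite eq_sym.
Qed.

(** * Orders that are perfect squares *)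

(** Induction on [n]: halving [n] stops at an odd number, or at 4 since halving
    once more would leave the range of the induction. *)
Lemma flat_order_square (C : numClosedFieldType) n :
  (2 < n)%N -> flat_order C (n ^ 2).
Proof.
elim/ltn_ind: n => n IH n2.
have [n_odd|n_even] := boolP (odd n).
  have n1 := ltnW n2; have [w w_prim] := @prim_root_existsC C n (ltnW n1).
  exact: (flat_order_odd_square n1 n_odd w_prim).
have [k Ek] : exists k, n = (2 * k)%N.
  by exists n./2; rewrite mul2n even_halfK.
have [k2|k2] := leqP k 2.
  by rewrite (_ : n = 4)%N; [exact: flat_order16 | lia].
rewrite Ek expnMn; apply: flat_order_quadruple; first by nia.
by apply: IH; lia.
Qed.

(** * From flat arrays to quantum Latin squares *)

Local Open Scope complex_scope.

Lemma orthonormal_basis_image (R : realType) (v : nat) (I : finType)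
    (P : {pred I}) (f : I -> 'rV[R[i]]_v) :
  #|P| = v ->
  {in P &, forall c c', dotmx (f c) (f c') = (c == c')%:R} ->
  orthonormal_basis [seq f c | c in P].
Proof.
move=> cardP f_orth; set s := image f P.
have f_inj : {in P &, injective f}.
  move=> c c' Pc Pc' E; have := f_orth c c' Pc Pc'.
  rewrite E f_orth // eqxx; case: eqVneq => // _ /eqP.
  by rewrite oner_eq0.
have s_on : orthonormal (@dotmx R[i] v) s.
  apply/orthonormalP; split.
    rewrite map_inj_in_uniq ?enum_uniq // => c c'; rewrite !mem_enum.
    exact: f_inj.
  move=> _ _ /imageP [c Pc ->] /imageP [c' Pc' ->].
  rewrite [LHS](f_orth _ _ Pc Pc'); congr (nat_of_bool _)%:R.
  by apply/eqP/eqP => [->|/f_inj ->].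
rewrite /orthonormal_basis s_on basisEfree (orthonormal_free s_on) subvf /=.
by rewrite size_image cardP dimvf /dim /= mul1n.
Qed.

Section Realisation.
Variables (R : realType) (N : nat) (X A : finType).
Variables (d : 'I_4 -> X -> A) (e : X -> A -> R[i]).
Hypothesis de : flat_array N d e.
Local Notation v := #|A|.

Lemma flat_line_bij i j : i != j -> bijective (fun c => (d i c, d j c)).
Proof.
move=> ij; apply: (inj_card_bij (flat_net de ij)).
by rewrite card_prod (flat_card de) expnS expn1.
Qed.

Definition flat_row (c : X) : 'rV[R[i]]_v :=
  \row_k ((sqrtC v%:R)^-1 * e c (enum_val k)).

Lemma dot_flat_row c c' : dotmx (flat_row c) (flat_row c') =
  v%:R^-1 * \sum_z e c z * (e c' z)^*.
Proof.
rewrite dotmxE mxE (reindex (@enum_rank A)) /=; last first.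
  by exists enum_val => z _; rewrite ?enum_rankK ?enum_valK.
rewrite mulr_sumr; apply: eq_bigr => z _; rewrite !mxE enum_rankK.
have s0 : 0 <= sqrtC (v%:R : R[i]) by rewrite sqrtC_ge0.
rewrite rmorphM /= mulrACA; congr (_ * _).
by rewrite conj_Creal ?rpredV ?ger0_real // -invfM -expr2 sqrtCK.
Qed.

Lemma flat_row_ortho i c c' : (0 < v)%N -> d i c = d i c' ->
  dotmx (flat_row c) (flat_row c') = (c == c')%:R.
Proof.
move=> v0 E; rewrite dot_flat_row; have [<-|ne] := eqVneq c c'.
  rewrite (eq_bigr (fun=> 1)) ?sumr_const ?mulVf ?pnatr_eq0 -?lt0n //.
  move=> z _; exact: (unity_mul_conj (flat_exp_gt0 de) (flat_unity de c z)).
by rewrite (flat_ortho de E ne) mulr0.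
Qed.

(** [flat_line_bij] provides such a [g]: the cell with given row and column. *)
Variable g : A * A -> X.
Hypothesis Kg : cancel g (fun c => (d ord0 c, d (inord 1) c)).

Definition cell (p : 'I_v * 'I_v) : X := g (enum_val p.1, enum_val p.2).

Lemma cell_row p : d ord0 (cell p) = enum_val p.1.
Proof. by have [] := Kg (enum_val p.1, enum_val p.2). Qed.

Lemma cell_col p : d (inord 1) (cell p) = enum_val p.2.
Proof. by have [] := Kg (enum_val p.1, enum_val p.2). Qed.

Lemma cell_inj : injective cell.
Proof.
move=> [i j] [i' j'] E.
have /enum_val_inj /= Ei : enum_val i = enum_val i'.
  by rewrite -[LHS](cell_row (i, j)) E cell_row.
have /enum_val_inj /= Ej : enum_val j = enum_val j'.
  by rewrite -[LHS](cell_col (i, j)) E cell_col.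
by rewrite Ei Ej.
Qed.

Lemma cell_line_bij s t : s != t ->
  bijective (fun p => (d s (cell p), d t (cell p))).
Proof.
move=> st; apply: inj_card_bij; last by rewrite !card_prod card_ord.
by move=> p q /(flat_net de st) /cell_inj.
Qed.

Definition array (i j : 'I_v) : 'rV[R[i]]_v := flat_row (cell (i, j)).

Definition line s (k : 'I_v) : {set 'I_v * 'I_v} :=
  [set p | d s (cell p) == enum_val k].

Lemma card_line s k : #|line s k| = v.
Proof.
have [t st] : exists t : 'I_4, s != t.
  have [->|] := eqVneq s ord0; last by exists ord0.
  by exists (inord 1); rewrite -val_eqE /= inordK.
have E : #|setX [set enum_val k] [set: A]| = v.
  by rewrite cardsX cards1 cardsT mul1n.
rewrite -[RHS]E.
rewrite -(on_card_preimset (onW_bij _ (cell_line_bij st))).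
by apply: eq_card => p; rewrite !inE andbT.
Qed.

Lemma card_lineI s t k l : s != t -> #|line s k :&: line t l| = 1%N.
Proof.
move=> st; rewrite -(cards1 (enum_val k, enum_val l)).
rewrite -(on_card_preimset (onW_bij _ (cell_line_bij st))).
by apply: eq_card => p; rewrite !inE xpair_eqE.
Qed.

Lemma line_basis s k : orthonormal_basis [seq array p.1 p.2 | p in line s k].
Proof.
apply: orthonormal_basis_image; first exact: card_line.
move=> p q; rewrite !inE => /eqP ps /eqP qs.
rewrite /array -!surjective_pairing (@flat_row_ortho s) ?ps ?qs //.
  by rewrite (inj_eq cell_inj).
exact: leq_ltn_trans (leq0n k) (ltn_ord k).
Qed.

Lemma array_QLS : is_QLS array.
Proof.
split=> k.
  apply: (@orthonormal_basis_image _ _ 'I_v predT); first by rewrite card_ord.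
  move=> i j _ _; rewrite /array (@flat_row_ortho ord0) ?cell_row //.
    by rewrite (inj_eq cell_inj) xpair_eqE eqxx.
  exact: leq_ltn_trans (leq0n k) (ltn_ord k).
apply: (@orthonormal_basis_image _ _ 'I_v predT); first by rewrite card_ord.
move=> i j _ _; rewrite /array (@flat_row_ortho (inord 1)) ?cell_col //.
  by rewrite (inj_eq cell_inj) xpair_eqE eqxx andbT.
exact: leq_ltn_trans (leq0n k) (ltn_ord k).
Qed.

Lemma array_RQLS : is_RQLS 2 array.
Proof.
split; first exact: array_QLS.
(* Classes 0 and 1 are the rows and columns, 2 and 3 the transversals. *)
pose cls (r : 'I_2) : 'I_4 := rshift 2 r.
exists (fun r k => line (cls r) k); split.
- move=> r k; split; last exact: line_basis.
  + move=> i; rewrite -(@card_lineI (cls r) ord0 k i) //.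
    by apply: eq_card => p; rewrite !inE cell_row (inj_eq enum_val_inj).
  + move=> j; rewrite -(@card_lineI (cls r) (inord 1) k j); last first.
      by rewrite -val_eqE /= inordK.
    by apply: eq_card => p; rewrite !inE cell_col (inj_eq enum_val_inj).
- move=> r k l kl; rewrite -setI_eq0; apply/eqP/setP => p; rewrite !inE.
  by apply: contraNF kl => /andP [/eqP -> ]; rewrite (inj_eq enum_val_inj).
- move=> r s k l rs; apply: card_lineI.
  by rewrite /cls (inj_eq (@rshift_inj 2 2)).
Qed.

Lemma array_maximal : maximal_cardinality array.
Proof.
rewrite /maximal_cardinality /cardinality.
set rel := (fun _ _ => _).
have rel_eq p q : rel p q = (p == q).
  apply/asboolP/eqP => [|->]; last first.
    by exists 0; rewrite cos0 sin0 scale1r.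
  case=> theta /rowP E.
  have v0 : (0 < v)%N := leq_ltn_trans (leq0n p.1) (ltn_ord p.1).
  have s0 : (sqrtC (v%:R : R[i]))^-1 != 0.
    by rewrite invr_eq0 sqrtC_eq0 pnatr_eq0 -lt0n.
  apply: cell_inj; apply: (flat_distinct de (k := cos theta +i* sin theta)) => z.
  have := E (enum_rank z); rewrite !mxE !enum_rankK -!surjective_pairing.
  by rewrite mulrCA => /(mulfI s0).
rewrite /equivalence_partition card_imset ?cardsT ?card_prod ?card_ord //.
by move=> p q /setP /(_ q); rewrite !inE !rel_eq eqxx => /eqP.
Qed.

End Realisation.

Lemma flat_order_RQLS (R : realType) (v : nat) : flat_order R[i] v ->
  exists Q : 'I_v -> 'I_v -> 'rV[R[i]]_v, is_RQLS 2 Q /\ maximal_cardinality Q.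
Proof.
move=> [N [X [A [d [e [de <-]]]]]].
have [|g _ Kg] := flat_line_bij de (i := ord0) (j := inord 1).
  by rewrite -val_eqE /= inordK.
exists (array e g); split; first exact: (array_RQLS de Kg).
exact: (array_maximal de Kg).
Qed.

Theorem theorem1p4 (R : realType) (n : nat) (hn : (6 <= n)%N) :
  exists Q : 'I_(n ^ 2) -> 'I_(n ^ 2) -> 'rV[R[i]%C]_(n ^ 2),
    is_RQLS 2 Q /\ maximal_cardinality Q.
Proof. by apply/flat_order_RQLS/flat_order_square; lia. Qed.
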